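(* Let $\mathcal{H}=\mathcal{H}_1\otimes\mathcal{H}_2\otimes\mathcal{H}_3$ with $\dim\mathcal{H}_i=d_i$ and $A:=3-d_1-d_2-d_3-d_1d_2-d_1d_3-d_2d_3+3d_1d_2d_3$. The mean of the entangling power $\epsilon_1$ over the unitary group $U(d_1d_2d_3)$ with respect to the Haar measure is $$\langle\epsilon_1\rangle_{U(d_1d_2d_3)}=\frac{2A}{3(d_1d_2d_3+1)},$$ and the mean over the orthogonal group $O(d_1d_2d_3)$ (real orthogonal matrices in a fixed product basis) with respect to the Haar measure is $$\langle\epsilon_1\rangle_{O(d_1d_2d_3)}=\frac{2A\left(\left[\prod_{i=1}^3d_i(d_i+1)\right]-8\right)}{3(d_1d_2d_3-1)(d_1d_2d_3+2)\left[\prod_{i=1}^3(d_i+1)\right]}.$$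
   Context: For a pure state $|\psi\rangle\in\mathcal{H}$ and a bipartition $g|g'$ of $\{1,2,3\}$, $\tau_{g|g'}(|\psi\rangle)=2\big(1-\operatorname{tr}[(\operatorname{tr}_g|\psi\rangle\langle\psi|)^2]\big)$; one-tangle is $\tau_1=\frac13(\tau_{12|3}+\tau_{13|2}+\tau_{23|1})$. The entangling power $\epsilon_1(U)$ of a unitary $U$ on $\mathcal{H}$ is the average of $\tau_1(U|\psi_{\rm sep}\rangle)$ over $|\psi_{\rm sep}\rangle=|\psi_1\rangle\otimes|\psi_2\rangle\otimes|\psi_3\rangle$, each $|\psi_i\rangle$ drawn independently from the unitarily invariant measure on pure states of $\mathcal{H}_i$. *)

(* Defs.v *)
From HB Require Import structures.
From mathcomp Require Import all_boot all_order all_algebra.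
From mathcomp Require Import reals.
From mathcomp Require Import complex.
Set Implicit Arguments. Unset Strict Implicit. Unset Printing Implicit Defensive.
Import Order.TTheory GRing.Theory Num.Theory.
Local Open Scope ring_scope.

Section Defs.
Variable R : realType.
Local Notation C := (R[i]).

Definition mxdist2 m n (A B : 'M[C]_(m, n)) : R :=
  \sum_(i < m) \sum_(j < n)
     ((complex.Re (A i j - B i j)) ^+ 2 + (complex.Im (A i j - B i j)) ^+ 2).

Definition cont_on m n (S : 'M[C]_(m, n) -> Prop) (f : 'M[C]_(m, n) -> R) :=
  forall A, S A -> forall e : R, 0 < e -> exists2 d : R, 0 < d &
    forall B, S B -> mxdist2 A B < d -> `|f B - f A| < e.

(* E is a normalized positive linear functional ("integral w.r.t. a probability
   measure") on the continuous real functions on S. *)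
Definition is_mean m n (S : 'M[C]_(m, n) -> Prop)
    (E : ('M[C]_(m, n) -> R) -> R) :=
  [/\ forall f g, cont_on S f -> cont_on S g -> E (fun x => f x + g x) = E f + E g,
      forall (c : R) f, cont_on S f -> E (fun x => c * f x) = c * E f,
      forall f, cont_on S f -> (forall x, S x -> 0 <= f x) -> 0 <= E f
    & E (fun _ => 1) = 1].

Definition adj m n (A : 'M[C]_(m, n)) : 'M[C]_(n, m) := (map_mx conjc A)^T.

Definition Umat N (U : 'M[C]_N) : Prop := adj U *m U = 1%:M.
Definition Omat N (U : 'M[C]_N) : Prop :=
  Umat U /\ forall i j, complex.Im (U i j) = 0.

Definition haar_mean N (G : 'M[C]_N -> Prop) (E : ('M[C]_N -> R) -> R) :=
  is_mean G E /\
  forall V f, G V -> cont_on G f -> E (fun U => f (V *m U)) = E f.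

Definition unit_vec d (v : 'cV[C]_d) : Prop := \sum_(i < d) conjc (v i 0) * v i 0 = 1.

Definition state_mean d (E : ('cV[C]_d -> R) -> R) :=
  is_mean (@unit_vec d) E /\
  forall (V : 'M[C]_d) f, Umat V -> cont_on (@unit_vec d) f ->
    E (fun v => f (V *m v)) = E f.

Variables d1 d2 d3 : nat.
Local Notation N := (d1 * d2 * d3)%N.

(* product basis index |i1> (x) |i2> (x) |i3> *)
Definition idx (i1 : 'I_d1) (i2 : 'I_d2) (i3 : 'I_d3) : 'I_N :=
  mxvec_index (mxvec_index i1 i2) i3.

Definition prodvec (v1 : 'cV[C]_d1) (v2 : 'cV[C]_d2) (v3 : 'cV[C]_d3) : 'cV[C]_N :=
  \sum_(i1 < d1) \sum_(i2 < d2) \sum_(i3 < d3)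
     (v1 i1 0 * v2 i2 0 * v3 i3 0) *: delta_mx (idx i1 i2 i3) 0.

Definition rho1 (psi : 'cV[C]_N) : 'M[C]_d1 :=
  \matrix_(a, b) \sum_(j < d2) \sum_(k < d3) psi (idx a j k) 0 * conjc (psi (idx b j k) 0).
Definition rho2 (psi : 'cV[C]_N) : 'M[C]_d2 :=
  \matrix_(a, b) \sum_(i < d1) \sum_(k < d3) psi (idx i a k) 0 * conjc (psi (idx i b k) 0).
Definition rho3 (psi : 'cV[C]_N) : 'M[C]_d3 :=
  \matrix_(a, b) \sum_(i < d1) \sum_(j < d2) psi (idx i j a) 0 * conjc (psi (idx i j b) 0).

Definition tau_of d (rho : 'M[C]_d) : R := 2 * (1 - complex.Re (\tr (rho *m rho))).

(* tau_{12|3} = tau_of (tr_{12} ...) etc. *)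
Definition tau1 (psi : 'cV[C]_N) : R :=
  (tau_of (rho3 psi) + tau_of (rho2 psi) + tau_of (rho1 psi)) / 3.

(* entangling power: average of tau1 (U psi_sep) over independent invariant
   pure states psi_i (product measure = iterated integral) *)
Definition eps1 (m1 : ('cV[C]_d1 -> R) -> R) (m2 : ('cV[C]_d2 -> R) -> R)
    (m3 : ('cV[C]_d3 -> R) -> R) (U : 'M[C]_N) : R :=
  m1 (fun v1 => m2 (fun v2 => m3 (fun v3 => tau1 (U *m prodvec v1 v2 v3)))).

Definition Aconst : int :=
  (3 - d1%:Z - d2%:Z - d3%:Z - (d1 * d2)%N%:Z - (d1 * d3)%N%:Z - (d2 * d3)%N%:Z
   + 3 * (d1 * d2 * d3)%N%:Z)%R.

End Defs.

(* Main.v *)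
(** Moments of degree (2,2) of a random vector [psi] form a 4-tensor
[T a b c e] = <psi_a psi_b psi_c^* psi_e^*>, and integrating over the unitary
or orthogonal group makes this tensor invariant under that group.  Invariance
under signed permutations and one reflection with entries 3/5, 4/5 already
forces [T = x [a=b][c=e] + y ([a=c][b=e] + [a=e][b=c])], and a diagonal phase
[i] kills [x] in the unitary case.  The coefficients follow from two
contractions: normalisation gives [N x + (N^2 + N) y = 1], and real orthogonal
matrices preserve [|sum_n psi_n^2|^2], whose mean over product states is the
product of the local means [2 / (d_i + 1)].  Every mean purity is linear in
[x] and [y].

All integrands are finite sums of products of continuous functions of the
separate variables, so no Fubini theorem is needed. *)

Require Import Defs.
From HB Require Import structures.
From mathcomp Require Import all_boot all_order all_algebra.
From mathcomp Require Import reals complex.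
From mathcomp Require Import all_fingroup boolp ring lra.
Import Order.TTheory GRing.Theory Num.Theory.
Local Open Scope ring_scope.

(** * Tensors invariant under the orthogonal or unitary group *)

Section InvariantTensors.
Set Implicit Arguments. Unset Strict Implicit.
Variables (R : realType) (N : nat).
Local Notation C := R[i].
Implicit Types (V : 'M[C]_N) (T : 'I_N -> 'I_N -> 'I_N -> 'I_N -> C).

(** Invariance under [V] on the first two slots and its conjugate on the last two. The sums are
    nested, so that a sparse row of [V] collapses them one index at a time. *)
Definition tensor_inv V T := forall a b c e,
  T a b c e = \sum_i V a i * (\sum_j V b j *
    (\sum_k conjc (V c k) * (\sum_l conjc (V e l) * T i j k l))).

Lemma sum_mul_delta (I : finType) (a : I) (F : I -> C) (w : C) :
  \sum_i (w * (i == a)%:R) * F i = w * F a.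
Proof.
rewrite (bigD1 a) //= eqxx mulr1 big1 ?addr0 // => i /negbTE ->.
by rewrite mulr0 mul0r.
Qed.

(** One family covers permutations, sign changes and diagonal phases. *)
Definition monomial_mx (s : 'S_N) (w : 'I_N -> C) : 'M[C]_N :=
  \matrix_(i, j) (w i * (j == s i)%:R).

Lemma adjE m n (A : 'M[C]_(m, n)) i j : adj A i j = conjc (A j i).
Proof. by rewrite !mxE. Qed.

Lemma conjc_monomial s w i j :
  conjc (monomial_mx s w i j) = conjc (w i) * (j == s i)%:R.
Proof. by rewrite mxE rmorphM /= conjc_nat. Qed.

Lemma monomial_Umat s w :
  (forall i, w i * conjc (w i) = 1) -> Umat (monomial_mx s w).
Proof.
(* For square matrices a right inverse is a left inverse; [V *m adj V] is easier because each row of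
   [V] has a single entry. *)
move=> hw; apply: mulmx1C; apply/matrixP => i j; rewrite !mxE.
under eq_bigr do rewrite adjE conjc_monomial mxE.
rewrite sum_mul_delta (inj_eq perm_inj); case: eqVneq => [->|_].
  by rewrite mulr1 hw.
by rewrite !mulr0.
Qed.

Lemma tensor_inv_monomial s w T : tensor_inv (monomial_mx s w) T ->
  forall a b c e, T a b c e =
    w a * (w b * (conjc (w c) * (conjc (w e) * T (s a) (s b) (s c) (s e)))).
Proof.
move=> hT a b c e; rewrite hT.
under eq_bigr do rewrite mxE; rewrite sum_mul_delta.
under eq_bigr do rewrite mxE; rewrite sum_mul_delta.
under eq_bigr do rewrite conjc_monomial; rewrite sum_mul_delta.
by under eq_bigr do rewrite conjc_monomial; rewrite sum_mul_delta.
Qed.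

Lemma conjc_id_Im (z : C) : complex.Im z = 0 -> conjc z = z.
Proof. by case: z => x y /= ->; rewrite oppr0. Qed.

(* The Householder reflection orthogonal to [u = e_a + 2 e_b]; it has rational
   entries, and its row [a] is [3/5 e_a - 4/5 e_b]. *)
Definition mixing_mx (a b : 'I_N) : 'M[C]_N :=
  let u : 'cV[C]_N := delta_mx a 0 + 2 *: delta_mx b 0 in
  1%:M - (2 / 5) *: (u *m u^T).

Lemma mixing_row a b j : a != b ->
  mixing_mx a b a j = 3 / 5 * (j == a)%:R + - (4 / 5) * (j == b)%:R.
Proof.
move=> ab; rewrite !mxE big_ord1 !mxE !eqxx !andbT (negbTE ab) (eq_sym a j).
by rewrite -[nat_of_bool true]/1%N -[nat_of_bool false]/0%N; field.
Qed.

Lemma mixing_real a b i j : complex.Im (mixing_mx a b i j) = 0.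
Proof.
suff h : conjc (mixing_mx a b i j) = mixing_mx a b i j.
  by move: h; case: (mixing_mx a b i j) => x y /= [] /eqP; rewrite eqNr => /eqP.
rewrite !mxE big_ord1 !mxE.
by rewrite !(rmorphB, rmorphM, rmorphD, rmorph_nat, fmorphV, rmorph1, conjc1).
Qed.

(** The reflection is real and symmetric, hence its own adjoint, and it squares to the identity
    because [u^T *m u] is 1 + 4 = 5. *)
Lemma mixing_Omat a b : a != b -> Omat (mixing_mx a b).
Proof.
move=> ab; split; last exact: mixing_real.
have adjV : adj (mixing_mx a b) = mixing_mx a b.
  apply/matrixP => i j; rewrite adjE conjc_id_Im ?mixing_real //.
  by rewrite !mxE !big_ord1 !mxE (eq_sym j i); congr (_ - _ * _); rewrite mulrC.
rewrite /Umat adjV.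
rewrite /mixing_mx; set u := (X in X *m X^T).
have uu : u^T *m u = 5%:M.
  have -> : u^T = delta_mx 0 a + 2 *: delta_mx 0 b.
    by apply/matrixP => i j; rewrite !mxE !(andbC (j == _)).
  rewrite /u mulmxDl !mulmxDr.
  rewrite -!scalemxAl -!scalemxAr !mul_delta_mx_cond !eqxx (eq_sym b) (negbTE ab).
  apply/matrixP => i j; rewrite !ord1 !mxE /=; ring.
rewrite mulmxBl !mulmxBr !mul1mx !mulmx1 -!scalemxAl -!scalemxAr.
rewrite mulmxA -(mulmxA u) uu mul_mx_scalar -scalemxAl !scalerA.
rewrite opprB addrC addrA addrAC -scalerBl -[X in _ - X + _]scale1r.
by apply/matrixP => i j; rewrite !mxE; field.
Qed.

Lemma sum_mixing a b (F : 'I_N -> C) : a != b ->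
  \sum_i mixing_mx a b a i * F i = 3 / 5 * F a - 4 / 5 * F b.
Proof.
move=> ab; under eq_bigr do rewrite mixing_row // mulrDl.
by rewrite big_split /= !sum_mul_delta mulNr.
Qed.

Lemma sum_conj_mixing a b (F : 'I_N -> C) : a != b ->
  \sum_i conjc (mixing_mx a b a i) * F i = 3 / 5 * F a - 4 / 5 * F b.
Proof.
move=> ab; rewrite -sum_mixing //; apply: eq_bigr => i _; congr (_ * _).
by rewrite conjc_id_Im ?mixing_real.
Qed.

(** * Classification of the tensors invariant under the orthogonal group *)

Section Orthogonal.
Variable T : 'I_N -> 'I_N -> 'I_N -> 'I_N -> C.
Hypothesis inv : forall V, Omat V -> tensor_inv V T.
Hypothesis sym : forall a b c e, T a b c e = T b a c e.

Lemma tensor_perm (s : 'S_N) a b c e : T a b c e = T (s a) (s b) (s c) (s e).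
Proof.
rewrite (@tensor_inv_monomial s (fun=> 1)) ?conjc1 ?mul1r //.
apply: inv; split=> [|i j]; first by apply: monomial_Umat => i; rewrite conjc1 mul1r.
by rewrite mxE mul1r; case: (_ == _).
Qed.

(** Flipping the sign of coordinate [k] multiplies the entry by -1 once for each index equal to [k];
    for an odd number of them the entry equals its opposite. *)
Lemma tensor_odd k a b c e :
  (a == k) (+) (b == k) (+) (c == k) (+) (e == k) -> T a b c e = 0.
Proof.
pose w i : C := if i == k then -1 else 1.
have /tensor_inv_monomial/(_ a b c e) : tensor_inv (monomial_mx 1 w) T.
  apply: inv; split=> [|i j].
    by apply: monomial_Umat => i; rewrite /w; case: ifP; rewrite ?rmorphN rmorph1 ?mulrNN mul1r.
  by rewrite mxE /w; case: (_ == k); case: (_ == _); rewrite ?mulr0 ?mulr1 //= oppr0.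
rewrite !perm1.
have wJ i : conjc (w i) = w i by rewrite /w; case: ifP; rewrite ?rmorphN rmorph1.
rewrite !wJ /w.
have neg0 (z : C) : z = - z -> z = 0.
  by move/eqP; rewrite -addr_eq0 -mulr2n mulrn_eq0 => /eqP.
by do 4 case: (_ == k) => //=; move=> h _; apply: neg0;
  rewrite {1}h ?(mulN1r, mul1r, opprK).
Qed.

(** The symmetric group is 2-transitive: first move [a] to [a'], then swap the image of [b] with
    [b'], which leaves [a'] fixed. *)
Lemma tensor_pair_trans (a b a' b' : 'I_N) : a != b -> a' != b' ->
  exists s : 'S_N, s a = a' /\ s b = b'.
Proof.
move=> ab ab'; pose s := tperm a a'; exists (s * tperm (s b) b')%g.
rewrite !permM; split; last by rewrite tpermL.
have sa : s a = a' by rewrite tpermL.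
by rewrite sa tpermD // -?sa eq_sym ?(inj_eq perm_inj) // sa.
Qed.

(** The reflection mixes [a] and [b], so expanding the entry [a a a a] relates it to the entries
    with two [a] and two [b]. Permutations alone could not link these orbits. *)
Lemma tensor_diag a b : a != b -> T a a a a = T a a b b + 2 * T a b a b.
Proof.
move=> ab; have ba : b != a by rewrite eq_sym.
have ab0 : (a == b) = false by apply: negbTE.
have ba0 : (b == a) = false by apply: negbTE.
have := @inv _ (mixing_Omat ab) a a a a.
do 2 rewrite ?sum_mixing //; rewrite ?sum_conj_mixing //.
(* The swap of [a] and [b], together with [sym], reduces the six balanced entries to two values. *)
have [s [sa sb]] := tensor_pair_trans ab ba.
have -> : T b b b b = T a a a a by rewrite (tensor_perm s) sb.
have -> : T b b a a = T a a b b by rewrite (tensor_perm s) sa sb.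
have -> : T b a b a = T a b a b by rewrite (tensor_perm s) sa sb.
have -> : T b a a b = T a b a b by rewrite sym.
have -> : T a b b a = T a b a b by rewrite sym (tensor_perm s) sa sb.
have odd := @tensor_odd a.
rewrite (odd a a a b) ?eqxx ?ab0 ?ba0 //.
rewrite (odd a a b a) ?eqxx ?ab0 ?ba0 //.
rewrite (odd a b a a) ?eqxx ?ab0 ?ba0 //.
rewrite (odd b a a a) ?eqxx ?ab0 ?ba0 //.
rewrite (odd a b b b) ?eqxx ?ab0 ?ba0 //.
rewrite (odd b a b b) ?eqxx ?ab0 ?ba0 //.
rewrite (odd b b a b) ?eqxx ?ab0 ?ba0 //.
rewrite (odd b b b a) ?eqxx ?ab0 ?ba0 //.
set p := T a a a a; set x := T a a b b; set y := T a b a b => h.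
(* Here 288/625 = 1 - (3/5)^4 - (4/5)^4 = 2 (3/5)^2 (4/5)^2, so the same factor stands on both sides
   of the relation. *)
have /eqP : (288 / 625) * (p - (x + 2 * y)) = 0.
  move/eqP: h; rewrite -subr_eq0 => /eqP h.
  by rewrite -[RHS]h; field.
rewrite mulf_eq0 subr_eq0 => /orP [|/eqP //].
by rewrite mulf_eq0 invr_eq0 !pnatr_eq0.
Qed.

(** Entries whose indices do not pair up vanish by [tensor_odd]; permutations make each pairing
    pattern constant; [tensor_diag] settles the case of four equal indices. *)
Lemma tensor_orthogonal : exists x y, forall a b c e, T a b c e =
  x * ((a == b)%:R * (c == e)%:R)
  + y * ((a == c)%:R * (b == e)%:R + (a == e)%:R * (b == c)%:R).
Proof.
case: (pickP (fun ab : 'I_N * 'I_N => ab.1 != ab.2)) => [[i j] /= ij|h]; last first.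
  (* No two distinct indices exist, so N is 0 or 1. For N = 1 all deltas are 1 and only x + 2 y is
     determined; the choice is x = 0. *)
  case: (pickP 'I_N) => [i _|h0]; last by exists 0, 0 => a; have := h0 a.
  have eqi a : a = i by apply/eqP; have := h (a, i); case: eqP.
  exists 0, (T i i i i / 2) => a b c e.
  by rewrite (eqi a) (eqi b) (eqi c) (eqi e) !eqxx -[nat_of_bool true]/1%N; field.
(* The coefficients are read off at one pair of distinct indices; 2-transitivity carries them to all
   pairs. *)
exists (T i i j j), (T i j i j).
have hx a' b' : a' != b' -> T a' a' b' b' = T i i j j.
  by move=> ab; have [s [sa sb]] := tensor_pair_trans ab ij; rewrite (tensor_perm s) sa sb.
have hy a' b' : a' != b' -> T a' b' a' b' = T i j i j.
  by move=> ab; have [s [sa sb]] := tensor_pair_trans ab ij; rewrite (tensor_perm s) sa sb.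
have hz a' b' : a' != b' -> T a' b' b' a' = T i j i j.
  by move=> ab; rewrite sym hy // eq_sym.
have hp a : T a a a a = T i i j j + 2 * T i j i j.
  have [b' ab] : exists b', a != b'.
    by case: (eqVneq a i) => [->|]; [exists j | exists i].
  by rewrite (tensor_diag ab) hx // hy.
pose simp := (eqxx, mulr0n, mulr1n, mulr0, mul0r, addr0, add0r, mulr1, mul1r).
move=> a b c e; have [->|ab] := eqVneq a b.
  have [->|ce] := eqVneq c e.
    have [->|be] := eqVneq b e; last by rewrite hx // !simp.
    by rewrite hp !simp mulrDr mulr1 mulr2n mulrDl mul1r.
  have [bc|bc] := eqVneq b c.
    have be : (b == e) = false by rewrite bc; apply/negbTE.
    rewrite -bc; by rewrite (@tensor_odd e) ?be ?simp.
  rewrite (eq_sym c) in ce.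
  by rewrite (@tensor_odd c) ?(negbTE bc) ?(negbTE ce) ?(eq_sym c) ?(negbTE ce) ?simp.
have ba : (b == a) = false by rewrite eq_sym; apply/negbTE.
have [<-|ac] := eqVneq a c.
  have [<-|be] := eqVneq b e; first by rewrite hy // ?ba !simp.
  by rewrite (@tensor_odd b) ?(negbTE ab) ?(eq_sym e b) ?(negbTE be) ?ba ?simp.
have [<-|ae] := eqVneq a e.
  have [<-|bc] := eqVneq b c; first by rewrite hz // ?ba !simp.
  by rewrite (@tensor_odd b) ?(negbTE ab) ?(eq_sym c b) ?(negbTE bc) ?ba ?simp.
by rewrite (@tensor_odd a) ?ba ?(eq_sym c) ?(negbTE ac) ?(eq_sym e) ?(negbTE ae) ?(negbTE ab) ?simp.
Qed.
End Orthogonal.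

Lemma tensor_unitary T :
  (forall V, Umat V -> tensor_inv V T) ->
  (forall a b c e, T a b c e = T b a c e) ->
  exists y, forall a b c e, T a b c e =
    y * ((a == c)%:R * (b == e)%:R + (a == e)%:R * (b == c)%:R).
Proof.
move=> inv sym.
have [V [/inv]//|x [y Txy]] := @tensor_orthogonal T _ sym.
case: (pickP (fun ab : 'I_N * 'I_N => ab.1 != ab.2)) => [[i j] /= ij|h].
  exists y => a b c e; rewrite Txy.
  suff -> : x = 0 by rewrite mul0r add0r.
  (* A phase of ['i] on coordinate [i] multiplies the entry [i i j j] by -1, and that entry is x. *)
  pose w k : C := if k == i then 'i%C else 1.
  have /tensor_inv_monomial/(_ i i j j) : tensor_inv (monomial_mx 1 w) T.
    apply/inv/monomial_Umat => k; rewrite /w; case: ifP => _; last by rewrite conjc1 mul1r.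
    by apply/eqP; rewrite eq_complex /= !(mulr0, mul0r, mulr1, mul1r, opprK, mulrN, oppr0, add0r, subr0, addr0) !eqxx.
  rewrite !perm1 /w eqxx eq_sym (negbTE ij) conjc1 !mul1r mulrA -expr2 sqr_i mulN1r.
  rewrite Txy !eqxx (negbTE ij) !(mulr0, addr0, mulr1) => /eqP.
  by rewrite -addr_eq0 -mulr2n mulrn_eq0 => /eqP.
have eqi (a b : 'I_N) : a == b by have := h (a, b); case: eqP.
(* For N at most 1 every delta is 1, so the x term is absorbed into the y term. *)
exists (y + x / 2) => a b c e.
by rewrite Txy !eqi -[nat_of_bool true]/1%N; field.
Qed.
End InvariantTensors.

(** * Complex-valued means and their iterates *)

Section ComplexMeans.
Set Implicit Arguments. Unset Strict Implicit.
Variable R : realType.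
Local Notation C := R[i].

(* [Cl] plays the role of the continuous functions on [S], and [L] of the
   integral against a probability measure on [S]. *)
Record cmean X (S : X -> Prop) (Cl : (X -> C) -> Prop) (L : (X -> C) -> C) :
    Prop := CMean {
  class_cst : forall c, Cl (fun=> c);
  class_add : forall f g, Cl f -> Cl g -> Cl (fun x => f x + g x);
  class_mul : forall f g, Cl f -> Cl g -> Cl (fun x => f x * g x);
  cmeanD : forall f g, Cl f -> Cl g -> L (fun x => f x + g x) = L f + L g;
  cmeanZ : forall c f, Cl f -> L (fun x => c * f x) = c * L f;
  cmean1 : L (fun=> 1) = 1;
  cmean_eq : forall f g, Cl f -> Cl g -> (forall x, S x -> f x = g x) -> L f = L g }.

Section Theory.
Variables (X : Type) (S : X -> Prop) (Cl : (X -> C) -> Prop) (L : (X -> C) -> C).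
Hypothesis hL : cmean S Cl L.

Lemma class_sum I (r : seq I) (f : I -> X -> C) :
  (forall i, Cl (f i)) -> Cl (fun x => \sum_(i <- r) f i x).
Proof.
move=> hf; elim: r => [|i r IH].
  by under eq_fun do rewrite big_nil; exact: (class_cst hL).
by under eq_fun do rewrite big_cons; exact: (class_add hL).
Qed.

Lemma cmean_cst c : L (fun=> c) = c.
Proof.
have := cmeanZ hL c (class_cst hL 1); rewrite (cmean1 hL) mulr1 => {2}<-.
by congr L; apply/funext => x; rewrite /= mulr1.
Qed.

Lemma cmean_sum I (r : seq I) (f : I -> X -> C) :
  (forall i, Cl (f i)) -> L (fun x => \sum_(i <- r) f i x) = \sum_(i <- r) L (f i).
Proof.
move=> hf; elim: r => [|i r IH].
  by rewrite big_nil -{2}(cmean_cst 0); congr L; apply/funext => x; rewrite big_nil.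
rewrite big_cons -IH -(cmeanD hL (hf i) (class_sum r hf)).
by congr L; apply/funext => x; rewrite big_cons.
Qed.

Lemma class_sumZ I (r : seq I) (c : I -> C) (f : I -> X -> C) :
  (forall i, Cl (f i)) -> Cl (fun x => \sum_(i <- r) c i * f i x).
Proof.
move=> hf; apply: (class_sum r (f := fun i x => c i * f i x)) => i.
by apply: (class_mul hL) => //; exact: (class_cst hL).
Qed.

Lemma cmean_sumZ I (r : seq I) (c : I -> C) (f : I -> X -> C) :
  (forall i, Cl (f i)) ->
  L (fun x => \sum_(i <- r) c i * f i x) = \sum_(i <- r) c i * L (f i).
Proof.
move=> hf; rewrite (cmean_sum r (f := fun i x => c i * f i x)).
  by apply: eq_bigr => i _; rewrite (cmeanZ hL).
by move=> i; apply: (class_mul hL); first exact: (class_cst hL).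
Qed.

End Theory.

(** * Iterated means on a product of two spaces *)

Section Product.
Variables (X Y : Type) (S : X -> Prop) (S' : Y -> Prop).
Variables (Cl : (X -> C) -> Prop) (Cl' : (Y -> C) -> Prop).
Variables (L : (X -> C) -> C) (L' : (Y -> C) -> C).
Hypotheses (hL : cmean S Cl L) (hL' : cmean S' Cl' L').

Inductive separable : (X * Y -> C) -> Prop :=
| separable_mul f g : Cl f -> Cl' g -> separable (fun p => f p.1 * g p.2)
| separable_add F G : separable F -> separable G -> separable (fun p => F p + G p).

Definition iter_mean (F : X * Y -> C) : C := L (fun x => L' (fun y => F (x, y))).

(** Induction on the sum: on a product [f] times [g] the inner mean is [f x] times a constant, hence
    admissible for the outer mean. *)
Lemma separableP F : separable F ->
  (forall x, Cl' (fun y => F (x, y))) /\ Cl (fun x => L' (fun y => F (x, y))).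
Proof.
elim=> {F} [f g hf hg|F G _ [F1 F2] _ [G1 G2]]; split.
- by move=> x /=; apply: (class_mul hL') => //; exact: (class_cst hL' (f x)).
- under eq_fun do rewrite /= (cmeanZ hL') //.
  by apply: (class_mul hL) => //; exact: (class_cst hL).
- by move=> x; apply: (class_add hL').
- by under eq_fun do rewrite (cmeanD hL') //; apply: (class_add hL).
Qed.

Lemma separable_l f : Cl f -> separable (fun p => f p.1).
Proof.
move=> hf; have := separable_mul hf (class_cst hL' 1).
by under eq_fun do rewrite mulr1.
Qed.

Lemma separable_r g : Cl' g -> separable (fun p => g p.2).
Proof.
move=> hg; have := separable_mul (class_cst hL 1) hg.
by under eq_fun do rewrite mul1r.
Qed.

Lemma separable_prod F G : separable F -> separable G ->
  separable (fun p => F p * G p).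
Proof.
elim=> {F} [f g hf hg|F F' _ IF _ IF'] hG; last first.
  by under eq_fun do rewrite mulrDl; exact: separable_add (IF hG) (IF' hG).
elim: hG => {G} [f' g' hf' hg'|G G' _ IG _ IG'].
  under eq_fun do rewrite mulrACA.
  exact: separable_mul (class_mul hL hf hf') (class_mul hL' hg hg').
by under eq_fun do rewrite mulrDr; exact: separable_add IG IG'.
Qed.

Lemma iter_mean_mul f g : Cl f -> Cl' g ->
  iter_mean (fun p => f p.1 * g p.2) = L f * L' g.
Proof.
move=> hf hg; rewrite mulrC -(cmeanZ hL) //; congr L; apply/funext => x /=.
by rewrite (cmeanZ hL') // mulrC.
Qed.

(** The iterated mean is again of the same kind, so the construction can be nested for any number of
    variables. *)
Lemma cmean_iter :
  cmean (fun p => S p.1 /\ S' p.2) separable iter_mean.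
Proof.
split.
- by move=> c; apply: (@separable_l (fun=> c)); exact: (class_cst hL).
- exact: separable_add.
- exact: separable_prod.
- move=> F G /separableP [F1 F2] /separableP [G1 G2].
  rewrite /iter_mean -(cmeanD hL) //; congr L; apply/funext => x.
  by rewrite (cmeanD hL').
- move=> c F /separableP [F1 F2]; rewrite /iter_mean -(cmeanZ hL) //.
  by congr L; apply/funext => x; rewrite (cmeanZ hL').
- by rewrite /iter_mean (cmean1 hL') (cmean1 hL).
- move=> F G /separableP [F1 F2] /separableP [G1 G2] FG.
  by apply: (cmean_eq hL) => // x Sx; apply: (cmean_eq hL') => // y Sy; apply: FG.
Qed.

End Product.

(** * Continuous functions and the complexification of a real mean *)

Section Continuity.
Variables (m n : nat) (S : 'M[C]_(m, n) -> Prop).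
Implicit Types f g : 'M[C]_(m, n) -> R.

Lemma cont_cst c : cont_on S (fun=> c).
Proof. by move=> A _ e e0; exists 1 => // B _ _; rewrite subrr normr0. Qed.

Lemma cont_add f g : cont_on S f -> cont_on S g -> cont_on S (fun x => f x + g x).
Proof.
move=> hf hg A SA e e0; have e20 : 0 < e / 2 by rewrite divr_gt0.
have [d d0 hd] := hf A SA _ e20; have [d' d'0 hd'] := hg A SA _ e20.
exists (Num.min d d'); first by rewrite lt_min d0.
move=> B SB; rewrite lt_min => /andP [/(hd _ SB) h /(hd' _ SB) h'].
rewrite opprD addrACA (le_lt_trans (ler_normD _ _)) //.
by rewrite [e]splitr ltrD.
Qed.

Lemma cont_mul f g : cont_on S f -> cont_on S g -> cont_on S (fun x => f x * g x).
Proof.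
move=> hf hg A SA e e0; pose K := 1 + `|f A| + `|g A|.
have K0 : 0 < K by rewrite /K -addrA ltr_pwDl // addr_ge0.
have e'0 : 0 < Num.min 1 (e / K) by rewrite lt_min ltr01 divr_gt0.
have [d d0 hd] := hf A SA _ e'0; have [d' d'0 hd'] := hg A SA _ e'0.
exists (Num.min d d'); first by rewrite lt_min d0.
move=> B SB; rewrite lt_min => /andP [/(hd _ SB) h /(hd' _ SB) h'].
move: h h'; rewrite !lt_min !ltr_pdivlMr // => /andP [h1 h2] /andP [h1' h2'].
have -> : f B * g B - f A * g A =
  (f B - f A) * (g B - g A) + (f A * (g B - g A) + g A * (f B - f A)) by ring.
apply: le_lt_trans (ler_normD _ _) _.
apply: le_lt_trans (lerD (lexx _) (ler_normD _ _)) _.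
rewrite !normrM; move: h2 h2'; rewrite /K.
move: (normr_ge0 (f B - f A)) (normr_ge0 (g B - g A)) (normr_ge0 (f A)) (normr_ge0 (g A)) h1 h1'.
set u := `|f B - f A|; set v := `|g B - g A|; set p := `|f A|; set q := `|g A|.
move=> u0 v0 p0 q0 u1 v1 hu hv.
(* Since u and v are below 1, the sum is at most max(u, v) (1 + p + q), which is below e by the
   choice of K. *)
case: (lerP u v) => uv; nra.
Qed.

(** The condition says that [h] is 1-Lipschitz, as are the real and imaginary parts; since [mxdist2]
    is a squared distance, the modulus is the square of [e]. *)
Lemma cont_coord (h : C -> R) i j :
  (forall z w, `|h z - h w| ^+ 2 <=
     complex.Re (w - z) ^+ 2 + complex.Im (w - z) ^+ 2) ->
  cont_on S (fun x => h (x i j)).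
Proof.
move=> hh A SA e e0; exists (e ^+ 2); first by rewrite exprn_gt0.
move=> B SB hB; rewrite -(@ltr_pXn2r _ 2) ?nnegrE ?(ltW e0) //.
apply: le_lt_trans hB; apply: le_trans (hh _ _) _.
rewrite /mxdist2 (bigD1 i) //= (bigD1 j) //= -addrA lerDl addr_ge0 //.
  by apply: sumr_ge0 => k _; rewrite addr_ge0 ?sqr_ge0.
by apply: sumr_ge0 => k _; apply: sumr_ge0 => l _; rewrite addr_ge0 ?sqr_ge0.
Qed.

Definition contC (F : 'M[C]_(m, n) -> C) : Prop :=
  cont_on S (fun x => complex.Re (F x)) /\ cont_on S (fun x => complex.Im (F x)).

Lemma contC_coord i j : contC (fun x => x i j).
Proof.
split; apply: cont_coord => [[a b]] [c d] /=.
  by rewrite real_normK ?num_real // -sqrrN opprB lerDl sqr_ge0.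
by rewrite real_normK ?num_real // -[X in X <= _]sqrrN opprB lerDr sqr_ge0.
Qed.

Lemma contC_conj F : contC F -> contC (fun x => conjc (F x)).
Proof.
move=> [hR hI]; split.
  rewrite (_ : (fun x => _) = (fun x => complex.Re (F x))) //.
  by apply/funext => x; case: (F x).
rewrite (_ : (fun x => _) = (fun x => -1 * complex.Im (F x))).
  by apply: cont_mul hI; apply: cont_cst.
by apply/funext => x; case: (F x) => a b /=; rewrite mulN1r.
Qed.

Definition meanC (E : ('M[C]_(m, n) -> R) -> R) (F : 'M[C]_(m, n) -> C) : C :=
  Complex (E (fun x => complex.Re (F x))) (E (fun x => complex.Im (F x))).

Lemma mean_le E f g : is_mean S E -> cont_on S f -> cont_on S g ->
  (forall x, S x -> f x <= g x) -> E f <= E g.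
Proof.
move=> [hD hZ hP h1] hf hg fg.
have hN : cont_on S (fun x => -1 * f x) by apply: cont_mul; first exact: cont_cst.
have := hP _ (cont_add hg hN); rewrite hD // hZ // mulN1r subr_ge0; apply => x Sx.
by rewrite mulN1r subr_ge0 fg.
Qed.

(** The functional takes functions on all matrices; positivity, used in both directions, shows that
    only the values on [S] matter. *)
Lemma mean_eq E f g : is_mean S E -> cont_on S f -> cont_on S g ->
  (forall x, S x -> f x = g x) -> E f = E g.
Proof.
move=> hE hf hg fg; apply: le_anti.
by rewrite !(mean_le hE) // => x /fg ->.
Qed.

Lemma cmean_meanC E : is_mean S E -> cmean S contC (meanC E).
Proof.
move=> hE; have [hD hZ hP h1] := hE; split.
- by move=> c; split; apply: cont_cst.
- move=> F G [FR FI] [GR GI]; split.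
    rewrite (_ : (fun x => _) = (fun x => complex.Re (F x) + complex.Re (G x))).
      exact: cont_add.
    by apply/funext => x; case: (F x) (G x) => [a b] [c d].
  rewrite (_ : (fun x => _) = (fun x => complex.Im (F x) + complex.Im (G x))).
    exact: cont_add.
  by apply/funext => x; case: (F x) (G x) => [a b] [c d].
- move=> F G [FR FI] [GR GI]; split.
    rewrite (_ : (fun x => _) = (fun x => complex.Re (F x) * complex.Re (G x)
        + (-1 * (complex.Im (F x) * complex.Im (G x))))).
      by apply: cont_add; do ?apply: cont_mul => //; apply: cont_cst.
    by apply/funext => x; case: (F x) (G x) => [a b] [c d] /=; rewrite mulN1r.
  rewrite (_ : (fun x => _) = (fun x => complex.Re (F x) * complex.Im (G x)
        + complex.Im (F x) * complex.Re (G x))).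
    by apply: cont_add; apply: cont_mul.
  by apply/funext => x; case: (F x) (G x) => [a b] [c d] /=.
- move=> F G [FR FI] [GR GI]; rewrite /meanC /=; apply/eqP; rewrite eq_complex /=.
  rewrite -!hD //; apply/andP; split; apply/eqP; congr E; apply/funext => x;
  by case: (F x) (G x) => [a b] [c d].
- move=> [a b] F [FR FI]; rewrite /meanC /=; apply/eqP; rewrite eq_complex /=.
  have cM c g : cont_on S g -> cont_on S (fun x => c * g x).
    by move=> hg; apply: cont_mul => //; apply: cont_cst.
  rewrite -mulNr -!hZ // -!hD //; do ?exact: cM.
  apply/andP; split; apply/eqP; congr E; apply/funext => x; case: (F x) => c d //=.
  by rewrite mulNr.
- rewrite /meanC /= h1; apply/eqP; rewrite eq_complex /= eqxx /=; apply/eqP.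
  by have := hZ 0 _ (cont_cst 1); rewrite !mul0r.
- move=> F G [FR FI] [GR GI] FG; rewrite /meanC; congr Complex;
  by apply: (mean_eq hE) => // x /FG ->.
Qed.

End Continuity.
End ComplexMeans.

(** * Moment tensors *)

Section Moments.
Set Implicit Arguments. Unset Strict Implicit.
Variable R : realType.
Local Notation C := R[i].

Definition quartic N (v : 'cV[C]_N) (a b c e : 'I_N) : C :=
  v a 0 * (v b 0 * (conjc (v c 0) * conjc (v e 0))).

(** Peels one level off a nested sum when the inner expression is a common factor times a function
    of the index. *)
Lemma sum_mul_factor (I : finType) (A w F : I -> C) K :
  (forall i, F i = w i * K) -> \sum_i A i * F i = (\sum_i A i * w i) * K.
Proof. by move=> h; rewrite mulr_suml; apply: eq_bigr => i _; rewrite h mulrA. Qed.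

Lemma conjc_mulmx N (V : 'M[C]_N) (v : 'cV[C]_N) c :
  conjc ((V *m v) c 0) = \sum_k conjc (V c k) * conjc (v k 0).
Proof. by rewrite mxE rmorph_sum; apply: eq_bigr => i _; rewrite rmorphM. Qed.

Lemma quartic_mulmx N (V : 'M[C]_N) (v : 'cV[C]_N) a b c e :
  quartic (V *m v) a b c e = \sum_i V a i * (\sum_j V b j *
    (\sum_k conjc (V c k) * (\sum_l conjc (V e l) * quartic v i j k l))).
Proof.
pose B := (V *m v) b 0; pose D := conjc ((V *m v) c 0).
pose G := conjc ((V *m v) e 0).
rewrite (@sum_mul_factor _ _ (fun i => v i 0) _ (B * (D * G))) => [|i].
  by rewrite /quartic mxE.
rewrite (@sum_mul_factor _ _ (fun i => v i 0) _ (v i 0 * (D * G))) => [|j].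
  by rewrite /B mxE mulrCA.
rewrite (@sum_mul_factor _ _ (fun k => conjc (v k 0)) _ (v j 0 * v i 0 * G)) => [|k].
  by rewrite /D conjc_mulmx; ring.
rewrite (@sum_mul_factor _ _ (fun k => conjc (v k 0)) _
  (v i 0 * v j 0 * conjc (v k 0))) => [|l].
  by rewrite /G conjc_mulmx; ring.
by rewrite /quartic; ring.
Qed.

Section Moment.
Variables (X : Type) (S : X -> Prop) (Cl : (X -> C) -> Prop) (L : (X -> C) -> C).
Hypothesis hL : cmean S Cl L.
Variables (N : nat) (psi : X -> 'cV[C]_N).
Hypothesis psi_class : forall a, Cl (fun x => psi x a 0).
Hypothesis psi_class_conj : forall a, Cl (fun x => conjc (psi x a 0)).

Definition moment a b c e := L (fun x => quartic (psi x) a b c e).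

Lemma quartic_class a b c e : Cl (fun x => quartic (psi x) a b c e).
Proof. by do 3 (apply: (class_mul hL) => //). Qed.

Lemma moment_sym a b c e : moment a b c e = moment b a c e.
Proof. by congr L; apply/funext => x; rewrite /quartic mulrCA. Qed.

(** A quartic monomial of [V *m psi] is multilinear in the entries of [V]; passing the mean through
    the four finite sums turns invariance of the mean into invariance of the tensor. *)
Lemma moment_inv V :
  (forall a b c e, L (fun x => quartic (V *m psi x) a b c e) = moment a b c e) ->
  tensor_inv V moment.
Proof.
move=> hV a b c e; rewrite -hV.
under [X in L X]eq_fun do rewrite quartic_mulmx.
rewrite (cmean_sumZ hL) => [|i]; last by do 3 (apply: (class_sumZ hL) => ?); exact: quartic_class.
apply: eq_bigr => i _; congr (_ * _).
rewrite (cmean_sumZ hL) => [|j]; last by do 2 (apply: (class_sumZ hL) => ?); exact: quartic_class.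
apply: eq_bigr => j _; congr (_ * _).
rewrite (cmean_sumZ hL) => [|k]; last by apply: (class_sumZ hL) => ?; exact: quartic_class.
apply: eq_bigr => k _; congr (_ * _).
by rewrite (cmean_sumZ hL) // => l; exact: quartic_class.
Qed.

(** The contracted integrand is the fourth power of the norm of [psi], which is 1 on [S]. *)
Lemma moment_norm : (forall x, S x -> unit_vec (psi x)) ->
  \sum_a \sum_b moment a b a b = 1.
Proof.
move=> hu.
have cl a : Cl (fun x => \sum_b quartic (psi x) a b a b).
  by apply: (class_sum hL) => b; exact: quartic_class.
rewrite -(cmean1 hL).
transitivity (L (fun x => \sum_a \sum_b quartic (psi x) a b a b)).
  rewrite (cmean_sum hL) //; apply: eq_bigr => a _.
  by rewrite (cmean_sum hL) // => b; exact: quartic_class.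
apply: (cmean_eq hL); [exact: (class_sum hL)|exact: (class_cst hL)|].
move=> x /hu ux; transitivity ((\sum_i conjc (psi x i 0) * psi x i 0) ^+ 2).
  rewrite expr2 mulr_suml; apply: eq_bigr => a _; rewrite mulr_sumr.
  by apply: eq_bigr => b _; rewrite /quartic; ring.
by rewrite ux expr1n.
Qed.

(** The squared modulus of the overlap of a vector with its complex conjugate. *)
Definition square_overlap (v : 'cV[C]_N) : C :=
  (\sum_i v i 0 ^+ 2) * conjc (\sum_i v i 0 ^+ 2).

Lemma square_overlap_quartic v :
  square_overlap v = \sum_a \sum_b quartic v a a b b.
Proof.
rewrite /square_overlap mulr_suml; apply: eq_bigr => a _.
rewrite rmorph_sum mulr_sumr; apply: eq_bigr => b _.
by rewrite rmorphXn /quartic; ring.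
Qed.

Lemma moment_square_overlap :
  \sum_a \sum_b moment a a b b = L (fun x => square_overlap (psi x)).
Proof.
under [X in _ = L X]eq_fun do rewrite square_overlap_quartic.
have cl a : Cl (fun x => \sum_b quartic (psi x) a a b b).
  by apply: (class_sum hL) => b; exact: quartic_class.
rewrite (cmean_sum hL) //; apply: eq_bigr => a _.
by rewrite (cmean_sum hL) // => b; exact: quartic_class.
Qed.

Lemma square_overlap_class : Cl (fun x => square_overlap (psi x)).
Proof.
under eq_fun do rewrite square_overlap_quartic.
by do 2 (apply: (class_sum hL) => ?); exact: quartic_class.
Qed.

(* With [g : A -> J -> 'I_N] the product basis of a bipartition, this is the
   purity of the state reduced to the [A] factor. *)
Definition purity (A J : finType) (g : A -> J -> 'I_N) (v : 'cV[C]_N) : C :=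
  \sum_a \sum_b \sum_j \sum_k quartic v (g a j) (g b k) (g b j) (g a k).

Lemma purity_class (A J : finType) (g : A -> J -> 'I_N) :
  Cl (fun x => purity g (psi x)).
Proof. by do 4 (apply: (class_sum hL) => ?); exact: quartic_class. Qed.

Lemma moment_purity (A J : finType) (g : A -> J -> 'I_N) :
  L (fun x => purity g (psi x)) =
    \sum_a \sum_b \sum_j \sum_k moment (g a j) (g b k) (g b j) (g a k).
Proof.
rewrite (cmean_sum hL) => [|a].
  apply: eq_bigr => a _; rewrite (cmean_sum hL) => [|b].
    apply: eq_bigr => b _; rewrite (cmean_sum hL) => [|j].
      apply: eq_bigr => j _; rewrite (cmean_sum hL) // => k.
      exact: quartic_class.
    by apply: (class_sum hL) => k; exact: quartic_class.
  by do 2 (apply: (class_sum hL) => ?); exact: quartic_class.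
by do 3 (apply: (class_sum hL) => ?); exact: quartic_class.
Qed.
End Moment.

(** * Contractions of the isotropic tensor *)

Section IsotropicTensor.
Variables (N : nat) (T : 'I_N -> 'I_N -> 'I_N -> 'I_N -> C) (x y : C).
Hypothesis TE : forall a b c e, T a b c e =
  x * ((a == b)%:R * (c == e)%:R)
  + y * ((a == c)%:R * (b == e)%:R + (a == e)%:R * (b == c)%:R).

Lemma sum_delta (I : finType) (a : I) : \sum_i (a == i)%:R = 1 :> C.
Proof.
by rewrite (bigD1 a) //= eqxx big1 ?addr0 // => i; rewrite eq_sym => /negbTE ->.
Qed.

Lemma sum_cst (I : finType) (c : C) : \sum_(i : I) c = #|I|%:R * c.
Proof. by rewrite sumr_const mulr_natl. Qed.

(** The three pairings force respectively a = b and j = k, only a = b, and only j = k, which gives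
    the three counts. *)
Lemma isotropic_purity (A J : finType) (g : A -> J -> 'I_N) :
  (forall a b j k, (g a j == g b k) = (a == b) && (j == k)) ->
  \sum_a \sum_b \sum_j \sum_k T (g a j) (g b k) (g b j) (g a k) =
    x * (#|A|%:R * #|J|%:R)
    + y * (#|A|%:R * #|J|%:R ^+ 2 + #|A|%:R ^+ 2 * #|J|%:R).
Proof.
move=> hg; have E a b j k : T (g a j) (g b k) (g b j) (g a k) =
    y * (a == b)%:R + (x * (a == b)%:R + y) * (j == k)%:R.
  rewrite TE !hg !eqxx (eq_sym b a) (eq_sym k j) !andbT /=.
  by case: (a == b); case: (j == k) => /=;
    rewrite -?[nat_of_bool true]/1%N -?[nat_of_bool false]/0%N; ring.
under eq_bigr => a _ do under eq_bigr => b _ do under eq_bigr => j _ do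
  (under eq_bigr => k _ do rewrite E; rewrite big_split /= sum_cst -mulr_sumr sum_delta mulr1).
under eq_bigr => a _ do under eq_bigr => b _ do rewrite sum_cst.
under eq_bigr => a _ do (rewrite -mulr_sumr !big_split /= sum_cst -mulr_sumr
   -!mulr_sumr !sum_delta).
by rewrite sum_cst; ring.
Qed.

Lemma isotropic_norm :
  \sum_a \sum_b T a b a b = x * N%:R + y * (N%:R ^+ 2 + N%:R).
Proof.
have E a b : T a b a b = y + (x + y) * (a == b)%:R.
  rewrite TE !eqxx (eq_sym b a).
  by case: (a == b); rewrite -?[nat_of_bool true]/1%N -?[nat_of_bool false]/0%N; ring.
under eq_bigr => a _ do (under eq_bigr => b _ do rewrite E;
  rewrite big_split /= sum_cst -mulr_sumr sum_delta).
by rewrite sum_cst !card_ord; ring.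
Qed.

Lemma isotropic_square :
  \sum_a \sum_b T a a b b = x * N%:R ^+ 2 + y * (2 * N%:R).
Proof.
have E a b : T a a b b = x + (2 * y) * (a == b)%:R.
  rewrite TE !eqxx.
  by case: (a == b); rewrite -?[nat_of_bool true]/1%N -?[nat_of_bool false]/0%N; ring.
under eq_bigr => a _ do (under eq_bigr => b _ do rewrite E;
  rewrite big_split /= sum_cst -mulr_sumr sum_delta).
by rewrite sum_cst !card_ord; ring.
Qed.

End IsotropicTensor.

Lemma Omat_Umat N (V : 'M[C]_N) : Omat V -> Umat V. Proof. by case. Qed.

(** Unitary invariance leaves one coefficient; normalisation makes it 1 / (d (d + 1)), and the
    contraction multiplies it by 2 d. *)
Lemma state_square_overlap d (m : ('cV[C]_d -> R) -> R) : (0 < d)%N ->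
  state_mean m ->
  meanC m (fun v => square_overlap v) = 2 / (d%:R + 1).
Proof.
move=> d0 [hm minv]; have hL := cmean_meanC hm.
have cl (a : 'I_d) := @contC_coord R d 1 (@unit_vec R d) a 0.
have clJ (a : 'I_d) := contC_conj (cl a).
have inv V : Umat V -> tensor_inv V (moment (meanC m) id).
  move=> hV; apply: (moment_inv hL cl clJ) => a b c e.
  have [hR hI] := quartic_class hL cl clJ a b c e.
  by rewrite /moment /meanC; congr Complex; [exact: (minv V _ hV hR)|exact: (minv V _ hV hI)].
have [y Ty] := tensor_unitary inv (moment_sym _ _).
(* The unitary form is restated with x = 0, so that the contraction lemmas apply. *)
have Ty' a b c e : moment (meanC m) id a b c e = 0 * ((a == b)%:R * (c == e)%:R)
    + y * ((a == c)%:R * (b == e)%:R + (a == e)%:R * (b == c)%:R).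
  by rewrite mul0r add0r Ty.
have := moment_norm hL cl clJ (fun v hv => hv).
rewrite (isotropic_norm Ty') -(moment_square_overlap hL cl clJ) (isotropic_square Ty').
rewrite !mul0r !add0r => hy.
have hd : d%:R != 0 :> C by rewrite pnatr_eq0 -lt0n.
have hd1 : d%:R + 1 != 0 :> C by rewrite -(natrD _ d 1) pnatr_eq0 addn1.
have -> : y = (d%:R * (d%:R + 1))^-1.
  by apply: (mulIf (mulf_neq0 hd hd1)); rewrite mulVf ?mulf_neq0 // -[RHS]hy; ring.
by field; rewrite hd hd1.
Qed.

End Moments.

(** * Tripartite product states *)

Section ProductBasis.
Set Implicit Arguments. Unset Strict Implicit.
Variables (R : realType) (d1 d2 d3 : nat).
Local Notation C := R[i].
Local Notation N := (d1 * d2 * d3)%N.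

Lemma mxvec_index_eq m n (i i' : 'I_m) (j j' : 'I_n) :
  (mxvec_index i j == mxvec_index i' j') = (i == i') && (j == j').
Proof.
by rewrite /mxvec_index (inj_eq (@cast_ord_inj _ _ _)) (inj_eq enum_rank_inj).
Qed.

Lemma idx_eq (i i' : 'I_d1) (j j' : 'I_d2) (k k' : 'I_d3) :
  (idx i j k == idx i' j' k') = [&& i == i', j == j' & k == k'].
Proof. by rewrite /idx !mxvec_index_eq andbA. Qed.

Lemma sum_mxvec_index m n (F : 'I_(m * n) -> C) :
  \sum_k F k = \sum_i \sum_j F (mxvec_index i j).
Proof.
rewrite (reindex (uncurry (@mxvec_index m n))) /=; last exact: curry_mxvec_bij.
by rewrite pair_bigA; apply: eq_bigr => -[].
Qed.

Lemma sum_idx (F : 'I_N -> C) :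
  \sum_n F n = \sum_i \sum_j \sum_k F (idx i j k).
Proof. by rewrite !sum_mxvec_index. Qed.

Lemma idxP (n : 'I_N) : exists i j k, n = idx i j k.
Proof.
by case/mxvec_indexP: n => ij k; case/mxvec_indexP: ij => i j; exists i, j, k.
Qed.

Lemma prodvecE (v1 : 'cV[C]_d1) (v2 : 'cV[C]_d2) (v3 : 'cV[C]_d3) i j k :
  prodvec v1 v2 v3 (idx i j k) 0 = v1 i 0 * v2 j 0 * v3 k 0.
Proof.
have Z i' j' k' : ~~ [&& i == i', j == j' & k == k'] ->
    ((v1 i' 0 * v2 j' 0 * v3 k' 0) *: delta_mx (idx i' j' k') 0 : 'cV[C]_N)
      (idx i j k) 0 = 0.
  by move=> /negbTE h; rewrite !mxE idx_eq h mulr0.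
rewrite summxE (bigD1 i) //= summxE (bigD1 j) //= summxE (bigD1 k) //=.
rewrite !big1 ?addr0 => [|i' ii'|j' jj'|k' kk'].
- by rewrite !mxE !eqxx mulr1.
- rewrite summxE big1 // => j' _; rewrite summxE big1 // => k' _; apply: Z.
  by rewrite eq_sym (negbTE ii').
- by rewrite summxE big1 // => k' _; apply: Z; rewrite (eq_sym j) (negbTE jj') andbF.
- by apply: Z; rewrite (eq_sym k) (negbTE kk') !andbF.
Qed.
(** A multiplicative [f] splits over the product coordinates. It serves for the squared modulus
    (norm) and for the square (overlap with the conjugate). *)
Lemma sum_prodvec (f : C -> C) (v1 : 'cV[C]_d1) (v2 : 'cV[C]_d2) (v3 : 'cV[C]_d3) :
  {morph f : x y / x * y} ->
  \sum_n f (prodvec v1 v2 v3 n 0) =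
    (\sum_i f (v1 i 0)) * (\sum_j f (v2 j 0)) * (\sum_k f (v3 k 0)).
Proof.
move=> fM; rewrite sum_idx -mulrA mulr_suml; apply: eq_bigr => i _.
rewrite mulr_suml mulr_sumr; apply: eq_bigr => j _.
by rewrite !mulr_sumr; apply: eq_bigr => k _; rewrite prodvecE !fM mulrA.
Qed.

Lemma prodvec_unit (v1 : 'cV[C]_d1) (v2 : 'cV[C]_d2) (v3 : 'cV[C]_d3) :
  unit_vec v1 -> unit_vec v2 -> unit_vec v3 -> unit_vec (prodvec v1 v2 v3).
Proof.
rewrite /unit_vec => h1 h2 h3.
rewrite (sum_prodvec (f := fun z => conjc z * z)) => [|x y].
  by rewrite h1 h2 h3 !mulr1.
by rewrite rmorphM mulrACA.
Qed.

Lemma prodvec_square_overlap (v1 : 'cV[C]_d1) (v2 : 'cV[C]_d2) (v3 : 'cV[C]_d3) :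
  square_overlap (prodvec v1 v2 v3) =
    square_overlap v1 * (square_overlap v2 * square_overlap v3).
Proof.
rewrite /square_overlap (sum_prodvec (f := fun z => z ^+ 2)) => [|x y].
  by rewrite !rmorphM; ring.
exact: exprMn.
Qed.

(** Each cut singles out one party and indexes the other two by a pair, so that [purity] treats the
    three bipartitions alike. *)
Definition cut1 (a : 'I_d1) (p : 'I_d2 * 'I_d3) : 'I_N := idx a p.1 p.2.
Definition cut2 (a : 'I_d2) (p : 'I_d1 * 'I_d3) : 'I_N := idx p.1 a p.2.
Definition cut3 (a : 'I_d3) (p : 'I_d1 * 'I_d2) : 'I_N := idx p.1 p.2 a.

Lemma cut1_eq a b j k : (cut1 a j == cut1 b k) = (a == b) && (j == k).
Proof. by case: j k => [? ?] [? ?]; rewrite idx_eq. Qed.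

Lemma cut2_eq a b j k : (cut2 a j == cut2 b k) = (a == b) && (j == k).
Proof. by case: j k => [? ?] [? ?]; rewrite idx_eq xpair_eqE andbCA. Qed.

Lemma cut3_eq a b j k : (cut3 a j == cut3 b k) = (a == b) && (j == k).
Proof. by case: j k => [? ?] [? ?]; rewrite idx_eq xpair_eqE andbA andbC. Qed.

(** Expanding [rho a b * rho b a] gives two sums over the traced-out factor, with indices j and k;
    regrouping the conjugates gives the quartic monomials. *)
Lemma tr_reduced_purity d (J : finType) (g : 'I_d -> J -> 'I_N) (psi : 'cV[C]_N)
    (rho : 'M[C]_d) :
  (forall a b, rho a b = \sum_j psi (g a j) 0 * conjc (psi (g b j) 0)) ->
  \tr (rho *m rho) = purity g psi.
Proof.
move=> hrho; apply: eq_bigr => a _; rewrite mxE; apply: eq_bigr => b _.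
rewrite !hrho mulr_suml; apply: eq_bigr => j _.
by rewrite mulr_sumr; apply: eq_bigr => k _; rewrite /quartic; ring.
Qed.

Lemma tr_rho1 (psi : 'cV[C]_N) : \tr (rho1 psi *m rho1 psi) = purity cut1 psi.
Proof. by apply: tr_reduced_purity => a b; rewrite mxE pair_bigA. Qed.

Lemma tr_rho2 (psi : 'cV[C]_N) : \tr (rho2 psi *m rho2 psi) = purity cut2 psi.
Proof. by apply: tr_reduced_purity => a b; rewrite mxE pair_bigA. Qed.

Lemma tr_rho3 (psi : 'cV[C]_N) : \tr (rho3 psi *m rho3 psi) = purity cut3 psi.
Proof. by apply: tr_reduced_purity => a b; rewrite mxE pair_bigA. Qed.

(** The one-tangle as 2 - 2/3 times the sum of the three purities, kept complex so that complex
    means apply before the real part is taken. *)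
Definition tau1C (psi : 'cV[C]_N) : C :=
  (2 : R)%:C%C + (- (2 / 3) : R)%:C%C * (purity cut3 psi + (purity cut2 psi + purity cut1 psi)).

Lemma tau1E (psi : 'cV[C]_N) : tau1 psi = complex.Re (tau1C psi).
Proof.
rewrite /tau1 /tau_of tr_rho1 tr_rho2 tr_rho3 /tau1C.
have affine (a b : R) z : complex.Re (a%:C + b%:C * z)%C = a + b * complex.Re z.
  by case: z => x y /=; rewrite mul0r subr0.
rewrite affine.
case: (purity cut3 psi) (purity cut2 psi) (purity cut1 psi) => [x ?] [y ?] [z ?] /=.
by field.
Qed.

End ProductBasis.

(** * Joint mean over the group and the three local states *)

Section RotatedProductStates.
Set Implicit Arguments. Unset Strict Implicit.
Variables (R : realType) (d1 d2 d3 : nat).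
Local Notation C := R[i].
Local Notation N := (d1 * d2 * d3)%N.
Hypotheses (hd1 : (0 < d1)%N) (hd2 : (0 < d2)%N) (hd3 : (0 < d3)%N).
Variables (m1 : ('cV[C]_d1 -> R) -> R) (m2 : ('cV[C]_d2 -> R) -> R)
  (m3 : ('cV[C]_d3 -> R) -> R).
Hypotheses (hm1 : state_mean m1) (hm2 : state_mean m2) (hm3 : state_mean m3).
Variables (G : 'M[C]_N -> Prop) (E : ('M[C]_N -> R) -> R).
Hypotheses (hE : haar_mean G E) (GU : forall V, G V -> Umat V).

Definition rotated (p : 'M[C]_N * ('cV[C]_d1 * ('cV[C]_d2 * 'cV[C]_d3))) : 'cV[C]_N :=
  p.1 *m prodvec p.2.1 p.2.2.1 p.2.2.2.

Let hE' : cmean G (contC G) (meanC E) := cmean_meanC hE.1.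
Let h1 := cmean_meanC hm1.1.
Let h2 := cmean_meanC hm2.1.
Let h3 := cmean_meanC hm3.1.
Let h23 := cmean_iter h2 h3.
Let h123 := cmean_iter h1 h23.
Let hL := cmean_iter hE' h123.

Local Notation class := (separable (contC G) (separable (contC (@unit_vec R d1))
  (separable (contC (@unit_vec R d2)) (contC (@unit_vec R d3))))).
Local Notation L := (iter_mean (meanC E) (iter_mean (meanC m1)
  (iter_mean (meanC m2) (meanC m3)))).

(** The real part of a complex mean is by definition the mean of the real part, and [L] iterates in
    the order of [eps1], with the group outermost. *)
Lemma eps1_mean : E (eps1 m1 m2 m3) = complex.Re (L (fun p => tau1C (rotated p))).
Proof.
congr E; apply/funext => U; congr m1; apply/funext => v1; congr m2.
by apply/funext => v2; congr m3; apply/funext => v3; exact: tau1E.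
Qed.

Lemma prodvec_class n : separable (contC (@unit_vec R d1))
  (separable (contC (@unit_vec R d2)) (contC (@unit_vec R d3)))
  (fun p => prodvec p.1 p.2.1 p.2.2 n 0).
Proof.
have [i [j [k ->]]] := idxP n; under eq_fun do rewrite prodvecE -mulrA.
exact: (separable_mul (contC_coord _ i 0)
  (separable_mul (contC_coord _ j 0) (contC_coord _ k 0))).
Qed.

Lemma prodvec_class_conj n : separable (contC (@unit_vec R d1))
  (separable (contC (@unit_vec R d2)) (contC (@unit_vec R d3)))
  (fun p => conjc (prodvec p.1 p.2.1 p.2.2 n 0)).
Proof.
have [i [j [k ->]]] := idxP n; under eq_fun do rewrite prodvecE !rmorphM -mulrA.
exact: (separable_mul (contC_conj (contC_coord _ i 0))
  (separable_mul (contC_conj (contC_coord _ j 0)) (contC_conj (contC_coord _ k 0)))).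
Qed.

Lemma rotated_class a : class (fun p => rotated p a 0).
Proof.
under eq_fun do rewrite mxE; apply: (class_sum hL) => n.
exact: (separable_mul (contC_coord _ a n) (prodvec_class n)).
Qed.

Lemma rotated_class_conj a : class (fun p => conjc (rotated p a 0)).
Proof.
under eq_fun do rewrite conjc_mulmx; apply: (class_sum hL) => n.
exact: (separable_mul (contC_conj (contC_coord _ a n)) (prodvec_class_conj n)).
Qed.

Lemma Umat_unit_vec n (V : 'M[C]_n) v : Umat V -> unit_vec v -> unit_vec (V *m v).
Proof.
have E' (w : 'cV[C]_n) : \sum_i conjc (w i 0) * w i 0 = (adj w *m w) 0 0.
  by rewrite mxE; apply: eq_bigr => i _; rewrite adjE.
rewrite /unit_vec !E' => hV <-.
have -> : adj (V *m v) = adj v *m adj V by rewrite /adj map_mxM trmx_mul.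
by rewrite -mulmxA (mulmxA (adj V)) hV mul1mx.
Qed.

Lemma rotated_unit p : [/\ G p.1, unit_vec p.2.1, unit_vec p.2.2.1 & unit_vec p.2.2.2] ->
  unit_vec (rotated p).
Proof. by case=> /GU hU u1 u2 u3; apply: Umat_unit_vec hU _; apply: prodvec_unit. Qed.

(** Applying [V] to the rotated state replaces the group element [U] by [V *m U], which the Haar
    mean absorbs. *)
Lemma rotated_moment_inv V : G V -> tensor_inv V (moment L rotated).
Proof.
move=> GV; apply: (moment_inv hL rotated_class rotated_class_conj) => a b c e.
(* Haar invariance needs the mean over the local states to be continuous in the group element. *)
have [_ [hR hI]] := separableP hE' h123
  (quartic_class hL rotated_class rotated_class_conj a b c e).
have -> : (fun p => quartic (V *m rotated p) a b c e) =
    (fun p => quartic (rotated (V *m p.1, p.2)) a b c e).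
  by apply/funext => p; rewrite /rotated mulmxA.
by congr Complex; [exact: (hE.2 V _ GV hR)|exact: (hE.2 V _ GV hI)].
Qed.
Lemma rotated_moment_norm : \sum_a \sum_b moment L rotated a b a b = 1.
Proof.
apply: (moment_norm hL rotated_class rotated_class_conj) => p [Gp [u1 [u2 u3]]].
exact: rotated_unit.
Qed.

(** A cut into factors of dimensions p and q with p q = N has mean purity N x + N y (p + q); the
    three cuts are added. *)
Lemma mean_tau1C x y :
  (forall a b c e, moment L rotated a b c e =
    x * ((a == b)%:R * (c == e)%:R)
    + y * ((a == c)%:R * (b == e)%:R + (a == e)%:R * (b == c)%:R)) ->
  L (fun p => tau1C (rotated p)) =
    2 - 2 / 3 * (3 * x * N%:R + y * N%:R * (d1%:R + d2%:R + d3%:R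
      + (d1 * d2)%:R + (d1 * d3)%:R + (d2 * d3)%:R)).
Proof.
move=> Txy.
have cl := purity_class hL rotated_class rotated_class_conj.
have add := class_add hL.
rewrite /tau1C (cmeanD hL); first last.
- apply: (class_mul hL); first exact: (class_cst hL).
  by apply: (add); last apply: (add); exact: cl.
- exact: (class_cst hL).
rewrite (cmean_cst hL) (cmeanZ hL); last first.
  by apply: (add); last apply: (add); exact: cl.
rewrite (cmeanD hL); [|exact: cl|by apply: (add); exact: cl].
rewrite (cmeanD hL); [|exact: cl|exact: cl].
rewrite !(moment_purity hL rotated_class rotated_class_conj).
rewrite (isotropic_purity Txy (@cut1_eq _ _ _)) (isotropic_purity Txy (@cut2_eq _ _ _)).
rewrite (isotropic_purity Txy (@cut3_eq _ _ _)).
rewrite !card_prod !card_ord rmorphN fmorph_div !rmorph_nat !natrM.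
by field.
Qed.

(** For a real [V] the transpose is the adjoint, so [V] preserves the bilinear form [w^T *m w]. *)
Lemma Omat_square_overlap n (V : 'M[C]_n) v : Omat V ->
  square_overlap (V *m v) = square_overlap v.
Proof.
move=> [hV real]; rewrite /square_overlap.
suff -> : \sum_i (V *m v) i 0 ^+ 2 = \sum_i v i 0 ^+ 2 by [].
have sq (w : 'cV[C]_n) : \sum_i w i 0 ^+ 2 = (w^T *m w) 0 0.
  by rewrite mxE; apply: eq_bigr => i _; rewrite mxE.
have VT : V^T = adj V.
  by apply/matrixP => i j; rewrite adjE mxE conjc_id_Im.
by rewrite !sq trmx_mul VT -mulmxA (mulmxA (adj V)) hV mul1mx.
Qed.

(** The overlap does not see the orthogonal rotation and factors over the parties, each contributing
    2 / (d_i + 1). *)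
Lemma rotated_square_overlap : (forall V, G V -> Omat V) ->
  L (fun p => square_overlap (rotated p)) =
    8 / ((d1%:R + 1) * (d2%:R + 1) * (d3%:R + 1)).
Proof.
move=> GO; have ov d (m : ('cV[C]_d -> R) -> R) (hm : is_mean (@unit_vec R d) m) :=
  square_overlap_class (cmean_meanC hm) (fun a => contC_coord _ a 0)
    (fun a => contC_conj (contC_coord _ a 0)).
have cl23 := separable_mul (ov _ _ hm2.1) (ov _ _ hm3.1).
have cl123 := separable_mul (ov _ _ hm1.1) cl23.
have -> : L (fun p => square_overlap (rotated p)) =
    L (fun p => square_overlap p.2.1 * (square_overlap p.2.2.1 * square_overlap p.2.2.2)).
  apply: (cmean_eq hL).
  - exact: (square_overlap_class hL rotated_class rotated_class_conj).
  - exact: (separable_r hE' cl123).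
  - by move=> p [/GO Op _]; rewrite Omat_square_overlap // prodvec_square_overlap.
transitivity (meanC m1 (fun v => square_overlap v) *
  (meanC m2 (fun v => square_overlap v) * meanC m3 (fun v => square_overlap v))).
  rewrite -(iter_mean_mul h2 h3 (ov _ _ hm2.1) (ov _ _ hm3.1)).
  rewrite -(iter_mean_mul h1 h23 (ov _ _ hm1.1) cl23).
  (* The integrand no longer depends on the group element, so the outer mean is that of a
     constant. *)
  set c := RHS; exact: (cmean_cst hE' c).
rewrite !state_square_overlap //; field.
by rewrite -!(natrD _ _ 1) !pnatr_eq0 !addn1.
Qed.

End RotatedProductStates.

(** * Closed forms of the two group means *)

Lemma AconstE (F : comPzRingType) (d1 d2 d3 : nat) :
  (Aconst d1 d2 d3)%:~R = 3 - d1%:R - d2%:R - d3%:R - d1%:R * d2%:R - d1%:R * d3%:R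
    - d2%:R * d3%:R + 3 * (d1%:R * d2%:R * d3%:R) :> F.
Proof. by rewrite /Aconst !(rmorphB, rmorphD, rmorphM) /= -?pmulrn ?natrM. Qed.

(** With x = 0, normalisation gives y = 1 / (N (N + 1)); substituting in [mean_tau1C] leaves A over
    N + 1. *)
Lemma mean_eps1_unitary (R : realType) (d1 d2 d3 : nat)
    (m1 : ('cV[R[i]]_d1 -> R) -> R) (m2 : ('cV[R[i]]_d2 -> R) -> R)
    (m3 : ('cV[R[i]]_d3 -> R) -> R) (E : ('M[R[i]]_(d1 * d2 * d3) -> R) -> R) :
  (0 < d1)%N -> (0 < d2)%N -> (0 < d3)%N ->
  state_mean m1 -> state_mean m2 -> state_mean m3 ->
  haar_mean (@Umat R (d1 * d2 * d3)%N) E ->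
  E (eps1 m1 m2 m3) =
    (2 * (Aconst d1 d2 d3)%:~R) / (3 * ((d1 * d2 * d3)%:R + 1)).
Proof.
move=> p1 p2 p3 hm1 hm2 hm3 hE.
have [y Ty] := tensor_unitary (rotated_moment_inv hm1 hm2 hm3 hE) (@moment_sym _ _ _ _ _).
have Txy a b c e : _ = 0 * ((a == b)%:R * (c == e)%:R) + _ :=
  etrans (Ty a b c e) (esym (etrans (congr1 (fun z => z + _) (mul0r _)) (add0r _))).
rewrite eps1_mean (mean_tau1C hm1 hm2 hm3 hE Txy).
have := rotated_moment_norm hm1 hm2 hm3 hE (fun V hV => hV).
rewrite (isotropic_norm Txy) mul0r add0r => hy.
(* The real right-hand side is viewed as the real part of its embedding, so the computation takes
   place in the complex field. *)
rewrite -[RHS]/(complex.Re (_%:C)%C); congr complex.Re.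
have hN : (d1 * d2 * d3)%:R != 0 :> R[i] by rewrite pnatr_eq0 -lt0n !muln_gt0 p1 p2.
have hN1 : (d1 * d2 * d3)%:R + 1 != 0 :> R[i] by rewrite -(natrD _ _ 1) pnatr_eq0 addn1.
have -> : y = ((d1 * d2 * d3)%:R * ((d1 * d2 * d3)%:R + 1))^-1.
  by apply: (mulIf (mulf_neq0 hN hN1)); rewrite mulVf ?mulf_neq0 // -[RHS]hy; ring.
rewrite fmorph_div !rmorphM rmorphD rmorph_int !rmorph_nat rmorph1 AconstE.
move: hN hN1; rewrite !natrM => hN hN1; field.
by rewrite hN1 !pnatr_eq0 -!lt0n p1 p2 p3.
Qed.

(** Two linear equations determine x and y: the normalisation [hn] and the overlap contraction [hs].
    The system is singular at N = 1. *)
Lemma mean_eps1_orthogonal (R : realType) (d1 d2 d3 : nat)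
    (m1 : ('cV[R[i]]_d1 -> R) -> R) (m2 : ('cV[R[i]]_d2 -> R) -> R)
    (m3 : ('cV[R[i]]_d3 -> R) -> R) (E : ('M[R[i]]_(d1 * d2 * d3) -> R) -> R) :
  (0 < d1)%N -> (0 < d2)%N -> (0 < d3)%N ->
  state_mean m1 -> state_mean m2 -> state_mean m3 ->
  haar_mean (@Omat R (d1 * d2 * d3)%N) E ->
  E (eps1 m1 m2 m3) =
    (2 * (Aconst d1 d2 d3)%:~R
       * ((\prod_(d <- [:: d1; d2; d3]) (d * (d + 1))%:R) - 8))
    / (3 * ((d1 * d2 * d3)%:R - 1) * ((d1 * d2 * d3)%:R + 2)
       * (\prod_(d <- [:: d1; d2; d3]) (d + 1)%:R)).
Proof.
move=> p1 p2 p3 hm1 hm2 hm3 hE.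
have [x [y Txy]] := tensor_orthogonal (rotated_moment_inv hm1 hm2 hm3 hE)
  (@moment_sym _ _ _ _ _).
rewrite eps1_mean (mean_tau1C hm1 hm2 hm3 hE Txy).
have := rotated_moment_norm hm1 hm2 hm3 hE (@Omat_Umat R _).
have := moment_square_overlap (cmean_iter (cmean_meanC hE.1) (cmean_iter (cmean_meanC hm1.1)
  (cmean_iter (cmean_meanC hm2.1) (cmean_meanC hm3.1))))
  (rotated_class hm1 hm2 hm3 hE) (rotated_class_conj hm1 hm2 hm3 hE).
rewrite (isotropic_norm Txy) (isotropic_square Txy) (rotated_square_overlap p1 p2 p3 hm1 hm2 hm3 hE (fun V hV => hV)) => hs hn.
rewrite -[RHS]/(complex.Re (_%:C)%C); congr complex.Re.
rewrite !big_cons !big_nil AconstE fmorph_div !(rmorphM, rmorphB, rmorphD) /=.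
rewrite !rmorph_nat !rmorph1.
rewrite ?natrM ?mulr1 in hs hn *.
have n0 d : (0 < d)%N -> d%:R != 0 :> R[i] by rewrite pnatr_eq0 lt0n.
have n1 d : d%:R + 1 != 0 :> R[i] by rewrite -(natrD _ _ 1) pnatr_eq0 addn1.
have N2 : d1%:R * d2%:R * d3%:R + 2 != 0 :> R[i].
  by rewrite -!natrM -natrD pnatr_eq0 addn2.
(* For N = 1 the denominator vanishes and the quotient is 0 by the convention for the inverse of 0;
   the mean is also 0, because x + 2 y = 1. *)
have [N1|N1] := eqVneq (d1 * d2 * d3)%N 1%N.
  move/eqP: N1; rewrite !muln_eq1 -andbA => /and3P [/eqP e1 /eqP e2 /eqP e3].
  move: hn; rewrite {}e1 {}e2 {}e3 => hn.
  have -> : x = 1 - 2 * y by rewrite -[X in X - _]hn; ring.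
  rewrite !mulr1n (_ : 1 * 1 * 1 - 1 = 0 :> R[i]); last by ring.
  by rewrite mulr0 !mul0r invr0 mulr0; field.
have {}N1 : d1%:R * d2%:R * d3%:R - 1 != 0 :> R[i].
  by rewrite -!natrM subr_eq0 pnatr_eq1.
move: hs hn (n0 _ p1) (n0 _ p2) (n0 _ p3) (n1 d1) (n1 d2) (n1 d3) N1 N2.
set a := d1%:R; set b := d2%:R; set c := d3%:R; set n := a * b * c.
set s := 8 / _ => hs hn a0 b0 c0 a1 b1 c1 N1 N2.
have N0 : n != 0 by rewrite !mulf_neq0.
have yE : y = (n - s) / (n * (n - 1) * (n + 2)).
  (* Subtracting the overlap equation from n times the normalisation eliminates x and leaves y n (n
     - 1) (n + 2). *)
  have -> : n - s = n * (x * n + y * (n ^+ 2 + n)) - (x * n ^+ 2 + y * (2 * n)).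
    by rewrite hn hs mulr1.
  by field; rewrite N0 N1 N2.
have -> : x = (1 - y * (n ^+ 2 + n)) / n by rewrite -[X in X - _]hn; field.
by rewrite yE /s /n; field; rewrite c1 b1 a1 N2 N1 c0 b0 a0.
Qed.

Theorem theorem3 (R : realType) (d1 d2 d3 : nat)
    (hd1 : (0 < d1)%N) (hd2 : (0 < d2)%N) (hd3 : (0 < d3)%N)
    (m1 : ('cV[R[i]]_d1 -> R) -> R) (m2 : ('cV[R[i]]_d2 -> R) -> R)
    (m3 : ('cV[R[i]]_d3 -> R) -> R) :
  state_mean m1 -> state_mean m2 -> state_mean m3 ->
  (forall E : ('M[R[i]]_(d1 * d2 * d3) -> R) -> R,
     haar_mean (@Umat R (d1 * d2 * d3)%N) E ->
     E (eps1 m1 m2 m3) =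
       (2 * (Aconst d1 d2 d3)%:~R) / (3 * ((d1 * d2 * d3)%:R + 1))) /\
  (forall E : ('M[R[i]]_(d1 * d2 * d3) -> R) -> R,
     haar_mean (@Omat R (d1 * d2 * d3)%N) E ->
     E (eps1 m1 m2 m3) =
       (2 * (Aconst d1 d2 d3)%:~R
          * ((\prod_(d <- [:: d1; d2; d3]) (d * (d + 1))%:R) - 8))
       / (3 * ((d1 * d2 * d3)%:R - 1) * ((d1 * d2 * d3)%:R + 2)
          * (\prod_(d <- [:: d1; d2; d3]) (d + 1)%:R))).
Proof.
move=> hm1 hm2 hm3; split=> E hE.
- exact: mean_eps1_unitary.
- exact: mean_eps1_orthogonal.
Qed.
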